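(* Let $\Lambda\colon\mathbb{R}\to[0,1]$, let $N_0:=\inf\{x\in\mathbb{R}\mid\Lambda(x)=0\}$, and let $c\in\mathbb{R}$. For $c\in\mathbb{R}$ let $F_c:=\mathbf 1_{[c,\infty)}$. Then: (a) $Q_\Lambda^-(F_c)=c$ if and only if $\Lambda>0$ on $(-\infty,c)$. In particular, $Q_\Lambda^-$ satisfies the constancy property (i.e. $Q_\Lambda^-(F_{c})=c$ for all $c\in\mathbb R$) if and only if $N_0=\infty$. (b) $Q_\Lambda^+(F_c)=c$ if and only if $\inf\{y\ge c\mid\Lambda(y)<1\}=c$. In particular, $Q_\Lambda^+$ satisfies the constancy property (i.e. $Q_\Lambda^+(F_{c})=c$ for all $c\in\mathbb R$) if and only if the set $\{x\in\mathbb R\mid\Lambda(x)<1\}$ is dense in $\mathbb{R}$.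
   Context: For $\Lambda\colon\mathbb{R}\to[0,1]$ and a cumulative distribution function $F$ on $\mathbb{R}$, $Q_\Lambda^-(F):=\inf\{x\in\mathbb{R}\mid F(x)\ge\Lambda(x)\}$ and $Q_\Lambda^+(F):=\inf\{x\in\mathbb{R}\mid F(x)>\Lambda(x)\}$, with values in $[-\infty,\infty]$ and $\inf\varnothing=\infty$. $F_c=\mathbf 1_{[c,\infty)}$ is the CDF of the Dirac measure at $c$. *)

(* Defs.v *)
From HB Require Import structures.
From mathcomp Require Import all_boot all_order all_algebra.
From mathcomp Require Import all_classical all_reals all_analysis.

Set Implicit Arguments.
Unset Strict Implicit.
Unset Printing Implicit Defensive.

Import Order.TTheory GRing.Theory Num.Theory.
Import numFieldNormedType.Exports.
Local Open Scope classical_set_scope.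
Local Open Scope ring_scope.

(* [cumulativeBounded 0 1] is the library's type of CDFs on the real line:
   nondecreasing right-continuous functions with limits 0 at -oo, 1 at +oo. *)
Notation CDF R := (cumulativeBounded (0 : R) (1 : R)).

(* [ereal_inf set0 = +oo]. *)
Definition inf_ext (R : realType) (A : set R) : \bar R :=
  ereal_inf [set x%:E | x in A].

Definition Qminus (R : realType) (Lambda : R -> R) (F : CDF R) : \bar R :=
  inf_ext [set x | F x >= Lambda x].

Definition Qplus (R : realType) (Lambda : R -> R) (F : CDF R) : \bar R :=
  inf_ext [set x | F x > Lambda x].

Definition dirac_cdf (R : realType) (c : R) : R -> R := \1_`[c, +oo[.

Section dirac_cdf_is_cdf.
Variables (R : realType) (c : R).

Lemma dirac_cdfE (x : R) : dirac_cdf c x = (c <= x)%R%:R.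
Proof.
by rewrite /dirac_cdf indicE mem_setE in_itv /= andbT.
Qed.

Lemma dirac_cdf_nd : {homo dirac_cdf c : x y / x <= y}.
Proof.
move=> x y xy; rewrite !dirac_cdfE ler_nat.
by case: (leP c x) => // cx; rewrite (le_trans cx xy).
Qed.

Lemma dirac_cdf_rc : right_continuous (dirac_cdf c).
Proof.
move=> x; have [cx|xc] := leP c x.
- apply: cvg_near_cst; near=> y.
  have xy : x <= y by near: y; exact: nbhs_right_ge.
  by rewrite !dirac_cdfE cx (le_trans cx xy).
- apply: cvg_near_cst; near=> y.
  rewrite !dirac_cdfE !leNgt xc; suff -> : y < c by [].
  by near: y; apply: nbhs_right_lt.
Unshelve. all: by end_near. Qed.

HB.instance Definition _ :=
  isCumulative.Build R _ R (dirac_cdf c) dirac_cdf_nd dirac_cdf_rc.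

Lemma dirac_cdfNy : dirac_cdf c x @[x --> -oo] --> (0 : R).
Proof.
apply: cvg_near_cst; near=> x.
rewrite dirac_cdfE leNgt; suff -> : x < c by [].
by near: x; apply: nbhs_ninfty_lt; rewrite num_real.
Unshelve. all: by end_near. Qed.

Lemma dirac_cdfy : dirac_cdf c x @[x --> +oo] --> (1 : R).
Proof.
apply: cvg_near_cst; near=> x.
rewrite dirac_cdfE; suff -> : c <= x by [].
by near: x; apply: nbhs_pinfty_ge; rewrite num_real.
Unshelve. all: by end_near. Qed.

HB.instance Definition _ :=
  isCumulativeBounded.Build R 0 1 (dirac_cdf c) dirac_cdfNy dirac_cdfy.

Lemma dirac_cdf_dirac (x : R) : (\d_c `]-oo, x] = (dirac_cdf c x)%:E)%E.
Proof.
by rewrite diracE dirac_cdfE mem_setE in_itv.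
Qed.

End dirac_cdf_is_cdf.

Definition constancy (R : realType) (Q : CDF R -> \bar R) : Prop :=
  forall c : R, Q (dirac_cdf c) = c%:E.

Definition N0 (R : realType) (Lambda : R -> R) : \bar R :=
  inf_ext [set x | Lambda x = 0].

(* Main.v *)
(* Since [0 <= Lambda <= 1] and [F_c] only takes the values 0 and 1,
   [{F_c >= Lambda}] is [[c, +oo[] together with the zeros of [Lambda], and
   [{F_c > Lambda}] is [[c, +oo[] intersected with [{Lambda < 1}]. *)
Require Import Defs.
From HB Require Import structures.
From mathcomp Require Import all_boot all_order all_algebra.
From mathcomp Require Import all_classical all_reals all_analysis.
Import Order.TTheory GRing.Theory Num.Theory.
Import numFieldNormedType.Exports.
Local Open Scope classical_set_scope.
Local Open Scope ring_scope.

(** Replaces an equation in the extended reals by order conditions in [R], the form in which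
    quantiles and density are handled below. *)
Lemma inf_ext_finP (R : realType) (A : set R) (c : R) :
  inf_ext A = c%:E <->
  (forall x, A x -> c <= x) /\ (forall d, c < d -> exists2 x, A x & x < d).
Proof.
split=> [Ac|[cA Acd]].
  split=> [x Ax|d cd].
    by rewrite -lee_fin -Ac; apply: ereal_inf_lbound; exists x.
  have : (inf_ext A < d%:E)%E by rewrite Ac lte_fin.
  by move=> /ereal_inf_lt[_ [x Ax <-]]; rewrite lte_fin; exists x.
apply/le_anti/andP; split; last first.
  by apply: le_ereal_inf_tmp => _ [x Ax <-]; rewrite lee_fin cA.
apply/lee_addgt0Pr => e e0.
have /Acd[x Ax xd] : c < c + e by rewrite ltrDl.
apply: (@le_trans _ _ x%:E); first by apply: ereal_inf_lbound; exists x.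
by rewrite lee_fin ltW.
Qed.

(** Every element of [A] is real and bounds the infimum away from [+oo]. For [N0], this says that
    [Lambda] has no zero. *)
Lemma inf_ext_pinftyP (R : realType) (A : set R) :
  inf_ext A = +oo%E <-> forall x, ~ A x.
Proof.
split=> [Ay x Ax|A0].
  have : (inf_ext A <= x%:E)%E by apply: ereal_inf_lbound; exists x.
  by rewrite Ay leye_eq.
suff -> : A = set0 by rewrite /inf_ext image_set0 ereal_inf0.
by rewrite -subset0 => x /A0.
Qed.

Lemma Qminus_dirac_cdfP (R : realType) (Lambda : R -> R)
    (Lambda01 : forall x, 0 <= Lambda x <= 1) (c : R) :
  Qminus Lambda (dirac_cdf c) = c%:E <-> forall x, x < c -> 0 < Lambda x.
Proof.
rewrite /Qminus inf_ext_finP /=; split=> [[cS _] x xc|Lambda_gt0].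
  rewrite ltNge; apply/negP => Lx0.
  have : c <= x by apply: cS; rewrite dirac_cdfE (leNgt c) xc.
  by rewrite leNgt xc.
split=> [x|d cd].
  rewrite dirac_cdfE; case: (leP c x) => // /Lambda_gt0 Lx.
  by rewrite leNgt Lx.
(* The point [c] serves for every [d]: the jump is attained, so [F_c] is 1 at [c], and
   [Lambda c <= 1]. *)
by exists c => //; rewrite dirac_cdfE lexx; case/andP: (Lambda01 c).
Qed.

Lemma Qplus_dirac_cdfE (R : realType) (Lambda : R -> R)
    (Lambda_ge0 : forall x, 0 <= Lambda x) (c : R) :
  Qplus Lambda (dirac_cdf c) = inf_ext [set y | c <= y /\ Lambda y < 1].
Proof.
congr inf_ext; apply/seteqP; split=> x /=; rewrite dirac_cdfE.
  by case: (leP c x) => //= _; rewrite ltNge Lambda_ge0.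
by case=> ->.
Qed.

(** Approximation from the right suffices for density, because it is available at every base point
    [c]. *)
Lemma dense_inf_extP (R : realType) (A : set R) :
  dense A <-> forall c, inf_ext [set y | c <= y /\ A y] = c%:E.
Proof.
split=> [dA c|infA U [x Ux] oU].
  apply/inf_ext_finP; split=> [x []//|d cd].
  have [||x [/=]] := dA `]c, d[%classic.
  - by exists ((c + d) / 2); rewrite /= in_itv /= !midf_lt.
  - exact: interval_open.
  by rewrite in_itv /= => /andP[cx xd] Ax; exists x => //; split => //; exact: ltW.
have [e /= e0 xeU] : nbhs x U by exact: open_nbhs_nbhs.
(* The right half [[x, x + e[] of the ball around [x] inside [U] already meets [A]. *)
have /inf_ext_finP[_ /(_ (x + e))] := infA x.
rewrite ltrDl => /(_ e0)[y [xy Ay] yxe].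
exists y; split=> //; apply: xeU => /=.
by rewrite distrC ger0_norm ?subr_ge0// ltrBlDl.
Qed.

Theorem lemma2p4 (R : realType) (Lambda : R -> R)
    (Lambda01 : forall x : R, 0 <= Lambda x <= 1) (c : R) :
  ((Qminus Lambda (dirac_cdf c) = c%:E <-> (forall x : R, x < c -> 0 < Lambda x)) /\
   (constancy (Qminus Lambda) <-> N0 Lambda = +oo%E)) /\
  ((Qplus Lambda (dirac_cdf c) = c%:E <->
      inf_ext [set y : R | c <= y /\ Lambda y < 1] = c%:E) /\
   (constancy (Qplus Lambda) <-> dense [set x : R | Lambda x < 1])).
Proof.
have Lambda_ge0 x : 0 <= Lambda x by case/andP: (Lambda01 x).
split; split.
- exact: Qminus_dirac_cdfP.
- rewrite /N0 inf_ext_pinftyP /=; split=> [cQ x Lx0|Lambda_neq0 d].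
    (* A zero [x] of [Lambda] breaks constancy at any point strictly to its right; [x + 1] is
       one. *)
    have /Qminus_dirac_cdfP - /(_ Lambda01 x) := cQ (x + 1).
    by rewrite ltrDl ltr01 Lx0 ltxx => /(_ isT).
  apply/Qminus_dirac_cdfP => // x _.
  by rewrite lt_neqAle Lambda_ge0 andbT eq_sym; apply/eqP.
- by rewrite Qplus_dirac_cdfE.
- rewrite dense_inf_extP; split=> H d; first by rewrite -Qplus_dirac_cdfE.
  by rewrite Qplus_dirac_cdfE.
Qed.
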